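(* Let $M$ be an $n \times n$ random real symmetric matrix drawn from an orthogonally invariant ensemble, and let $b$ be any nonzero (deterministic) vector in $\mathbb{R}^n$. Then $(M,b)$ is controllable with probability one.
   Context: Controllability: for an $n \times n$ matrix $A$ and a vector $b \in \mathbb{R}^n$, the pair $(A,b)$ is controllable if the $n \times n$ matrix with columns $b, Ab, \ldots, A^{n-1}b$ has rank $n$. Orthogonally invariant ensemble: an $n \times n$ random real symmetric matrix $M$ is drawn from an orthogonally invariant ensemble if it has probability distribution $$\mathbb{P}(dM) = \frac{1}{Z_n} \exp(-\operatorname{tr} Q(M))\, dM$$ on the space of $n \times n$ real symmetric matrices, where $dM$ is Lebesgue measure on the $n(n+1)/2$ algebraically independent entries of $M$ (the entries on and above the diagonal), $Q$ is a real-valued function on $\mathbb{R}$, $Q(M)$ is defined by the functional calculus for $M$ (so $\operatorname{tr} Q(M) = \sum_{i=1}^n Q(\lambda_i)$ with $\lambda_1, \ldots, \lambda_n$ the eigenvalues of $M$), and $Z_n = \int e^{-\operatorname{tr} Q(M)}\, dM$ is the normalization constant. It is implicit that $Q$ is such that this defines a probability distribution (i.e. $Q$ is measurable and $0 < Z_n < \infty$). *)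

(* Defs.v *)
From HB Require Import structures.
From mathcomp Require Import all_boot all_order all_algebra.
From mathcomp Require Import all_classical all_reals all_analysis.
From mathcomp Require complex.
From mathcomp Require Import ring.

Set Implicit Arguments.
Unset Strict Implicit.
Unset Printing Implicit Defensive.

Import Order.TTheory GRing.Theory Num.Theory.
Import numFieldNormedType.Exports.

Local Open Scope classical_set_scope.
Local Open Scope ring_scope.

Section functional_calculus.
Import complex.
Context {R : realType}.

Lemma symmetric_eigenvalue n (A : 'M[R]_n.+1) : A \is symmetricmx ->
  exists a, eigenvalue A a.
Proof.
move=> Asym; pose f := complex.real_complex R.
pose AC := map_mx f A.
have ACs : AC \is symmetricmx.
  move: Asym; rewrite !qualifE /= !expr0 !scale1r !map_mx_id// => /eqP AT.
  by rewrite /AC map_trmx -AT.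
have ACr : AC \is a mxOver Num.real.
  by apply/mxOverP => i j; rewrite mxE; apply/complex.complex_realP; exists (A i j).
have ACh := realsym_hermsym ACs ACr.
have /mxOverP/(_ ord0 ord0) := hermitian_spectral_diag_real ACh.
move=> /complex.complex_realP[a Da]; exists a.
rewrite -(eigenvalue_map f) -/AC; apply/eigenvalueP.
have /hermitian_normalmx /orthomx_spectralP E := ACh.
have Pu := spectral_unit AC.
have PA : spectralmx AC *m AC = diag_mx (spectral_diag AC) *m spectralmx AC.
  by rewrite [X in _ *m X = _]E !mulmxA mulmxV// mul1mx.
exists (row 0 (spectralmx AC)).
  by rewrite -row_mul PA row_mul row_diag_mx Da -scalemxAl -rowE.
apply/negP => /eqP /(congr1 (mulmx^~ (invmx (spectralmx AC)))).
rewrite -row_mul mulmxV// mul0mx.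
by move=> /matrixP/(_ 0 0); rewrite !mxE/= => /eqP; rewrite oner_eq0.
Qed.

Lemma householder n (v : 'rV[R]_n.+1) : v *m v^T = 1%:M ->
  exists H : 'M[R]_n.+1, H *m H^T = 1%:M /\ row 0 H = v.
Proof.
move=> vv1; set e : 'rV[R]_n.+1 := delta_mx 0 0.
have [->|ve] := eqVneq v e.
  by exists 1%:M; rewrite trmx1 mulmx1 row1.
pose w := v - e; pose s := (w *m w^T) 0 0.
have ee : e *m e^T = 1%:M.
  by rewrite /e trmx_delta mul_delta_mx; apply/matrixP=> i j; rewrite !ord1 !mxE.
have ev : e *m v^T = v *m e^T.
  by rewrite -[LHS]trmxK trmx_mul trmxK; apply/matrixP=> i j; rewrite !ord1 !mxE.
have ww : w *m w^T = s%:M by rewrite [LHS]mx11_scalar.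
have s0 : s != 0.
  apply/negP => /eqP s0; move/eqP: ve; apply; apply/eqP; rewrite -subr_eq0.
  apply/eqP/rowP => i; rewrite mxE; move: s0; rewrite /s mxE.
  under eq_bigr do rewrite [w^T _ _]mxE -expr2.
  move/psumr_eq0P => /(_ (fun i _ => sqr_ge0 _)) /(_ i isT) /eqP.
  by rewrite sqrf_eq0 => /eqP; rewrite !mxE.
have wT : w^T = v^T - e^T by rewrite /w linearB.
have ew : e *m w^T = (- (s / 2%:R))%:M.
  have sE : w *m w^T = (2%:R : R) *: ((1%:M - v *m e^T) : 'M[R]_1).
    rewrite wT /w mulmxBr !mulmxBl vv1 ee ev scaler_nat mulr2n.
    by rewrite opprB.
  rewrite wT mulmxBr ee ev -opprB.
  have -> : 1%:M - v *m e^T = (2%:R : R)^-1 *: (w *m w^T).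
    by rewrite sE scalerA mulVf ?pnatr_eq0// scale1r.
  by rewrite ww scale_scalar_mx -raddfN /= mulrC.
pose H : 'M[R]_n.+1 := 1%:M - (2%:R / s) *: (w^T *m w).
have HT : H^T = H.
  by rewrite /H linearB/= trmx1 linearZ/= trmx_mul trmxK.
exists H; split.
  have NN : w^T *m w *m (w^T *m w) = s *: (w^T *m w).
    by rewrite mulmxA -(mulmxA w^T) ww mul_mx_scalar -scalemxAl.
  rewrite HT /H mulmxBr mulmx1 mulmxBl mul1mx -scalemxAl -scalemxAr NN !scalerA.
  rewrite -addrA -opprD -scalerBl -scalerDl [X in X *: _](_ : _ = 0).
    by rewrite scale0r subr0.
  by field.
rewrite rowE -/e /H mulmxBr mulmx1 -scalemxAr mulmxA ew mul_scalar_mx scalerA.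
rewrite mulrN mulrA divfK// divff ?pnatr_eq0// scaleN1r opprK /w.
by rewrite addrC subrK.
Qed.

Lemma symmetric_spectral n (A : 'M[R]_n) : A \is symmetricmx ->
  exists (U : 'M[R]_n) (d : 'rV[R]_n),
    U *m U^T = 1%:M /\ A = U^T *m diag_mx d *m U.
Proof.
have symE m (B : 'M[R]_m) : (B \is symmetricmx) = (B == B^T).
  by rewrite qualifE /= expr0 scale1r map_mx_id.
elim: n A => [|n IH] A.
  by exists 1%:M, 0; split; apply/matrixP => -[].
move=> Asym; have [a /eigenvalueP[u uA u0]] := symmetric_eigenvalue Asym.
move: Asym; rewrite symE => /eqP AT.
pose s := (u *m u^T) 0 0.
have s0 : 0 < s.
  rewrite lt_def /s mxE; under eq_bigr do rewrite [u^T _ _]mxE -expr2.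
  rewrite sumr_ge0 ?andbT; last by move=> i _; exact: sqr_ge0.
  apply: contra_neqN u0 => /eqP /psumr_eq0P H; apply/rowP => i.
  by move: (H (fun i _ => sqr_ge0 _) i isT) => /eqP; rewrite sqrf_eq0 mxE => /eqP.
pose v := (Num.sqrt s)^-1 *: u.
have vA : v *m A = a *: v by rewrite -scalemxAl uA !scalerA mulrC.
have vv : v *m v^T = 1%:M.
  rewrite linearZ/= -scalemxAr -scalemxAl scalerA [u *m _]mx11_scalar -/s.
  rewrite scale_scalar_mx -invfM -expr2 sqr_sqrtr ?ltW// mulVf//.
  by rewrite gt_eqF.
have [H [HH Hv]] := householder vv.
have HH' := mulmx1C HH.
pose B : 'M[R]_(1 + n) := H *m A *m H^T.
have BT : B = B^T by rewrite /B !trmx_mul trmxK -AT mulmxA.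
have Brow : row 0 B = a *: row 0 1%:M.
  by rewrite /B 2!row_mul Hv vA -scalemxAl -Hv -row_mul HH.
have Bur : ursubmx B = 0.
  apply/matrixP => i j; rewrite !mxE.
  have /rowP/(_ (rshift 1 j)) := Brow; rewrite !mxE.
  by rewrite ord1 (_ : lshift n 0 = 0)//=; [rewrite mulr0|exact/val_inj].
have Bdl : dlsubmx B = 0 by rewrite BT -trmx_ursub Bur trmx0.
have Bul : ulsubmx B = a%:M.
  apply/matrixP => i j; rewrite !mxE !ord1 eqxx.
  have /rowP/(_ 0) := Brow; rewrite !mxE/= mulr1 => <-.
  by rewrite (_ : lshift n 0 = 0) //; exact/val_inj.
have [U [d [UU Ud]]] : exists (U : 'M[R]_n) (d : 'rV[R]_n),
    U *m U^T = 1%:M /\ drsubmx B = U^T *m diag_mx d *m U.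
  by apply: IH; rewrite symE trmx_drsub -BT.
pose K : 'M[R]_(1 + n) := block_mx 1%:M 0 0 U.
have KT : K^T = block_mx 1%:M 0 0 U^T by rewrite tr_block_mx !trmx0 trmx1.
have KK : K *m K^T = 1%:M.
  rewrite KT mulmx_block !mulmx0 !mul0mx !mulmx1 !addr0 add0r UU.
  by rewrite -scalar_mx_block.
have KDK : K^T *m diag_mx (row_mx a%:M d) *m K = B.
  rewrite -[B]submxK Bul Bur Bdl Ud KT diag_mx_row !mulmx_block.
  rewrite !mulmx0 !mul0mx !mulmx1 !mul1mx !addr0 !add0r ?mulmx0 ?mul0mx ?addr0.
  by congr block_mx; apply/matrixP => i j; rewrite !mxE !ord1.
exists (K *m H), (row_mx a%:M d); rewrite trmx_mul; split.
  by rewrite mulmxA -(mulmxA K) HH mulmx1.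
rewrite [RHS](_ : _ = H^T *m (K^T *m diag_mx (row_mx a%:M d) *m K) *m H).
  by rewrite KDK /B !mulmxA HH' mul1mx -mulmxA HH' mulmx1.
by rewrite !mulmxA.
Qed.

(* Q acts on the eigenvalues: Q(U^T diag(d) U) = U^T diag(Q(d)) U for U
   orthogonal. The chosen value is independent of the diagonalization
   (mxfun_diag) and one exists for every symmetric A (symmetric_spectral);
   mxfun Q A is 0 when A is not orthogonally diagonalizable. *)
Definition mxfun (n : nat) (Q : R -> R) (A : 'M[R]_n) : 'M[R]_n :=
  xget 0 [set B | exists (U : 'M[R]_n) (d : 'rV[R]_n),
    [/\ U *m U^T = 1%:M, A = U^T *m diag_mx d *m U &
        B = U^T *m diag_mx (map_mx Q d) *m U]].

Lemma mxfun_diag n (Q : R -> R) (U : 'M[R]_n) (d : 'rV[R]_n) :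
  U *m U^T = 1%:M ->
  mxfun Q (U^T *m diag_mx d *m U) = U^T *m diag_mx (map_mx Q d) *m U.
Proof.
move=> UU; apply: xget_unique; first by exists U, d.
move=> B [V [e [VV UV ->]]].
pose W := V *m U^T.
have WU : W *m U = V by rewrite -mulmxA (mulmx1C UU) mulmx1.
have Wde : W *m diag_mx d = diag_mx e *m W.
  rewrite -[diag_mx d]mulmx1 -UU /W !mulmxA -(mulmxA V) -(mulmxA V).
  by rewrite [_ *m U]UV !mulmxA VV mul1mx.
have VW : V^T *m W = U^T by rewrite mulmxA (mulmx1C VV) mul1mx.
clearbody W.
have WQ : W *m diag_mx (map_mx Q d) = diag_mx (map_mx Q e) *m W.
  apply/matrixP => i j; have /matrixP/(_ i j) := Wde.
  rewrite !mul_mx_diag !mul_diag_mx !mxE => Wij.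
  have [->|Wn0] := eqVneq (W i j) 0; first by rewrite mul0r mulr0.
  by move: Wij; rewrite mulrC => /(mulIf Wn0) ->; rewrite mulrC.
have -> : V^T *m diag_mx (map_mx Q e) *m V =
    V^T *m (diag_mx (map_mx Q e) *m W) *m U by rewrite -!mulmxA WU.
by rewrite -WQ (mulmxA V^T) VW.
Qed.

Lemma trace_mxfun n (Q : R -> R) (A : 'M[R]_n) (l : n.-tuple R) :
  A \is symmetricmx -> char_poly A = \prod_(x <- l) ('X - x%:P) ->
  \tr (mxfun Q A) = \sum_(x <- l) Q x.
Proof.
move=> /symmetric_spectral[U [d [UU ->]]] Al; rewrite mxfun_diag//.
rewrite mxtrace_mulC mulmxA UU mul1mx mxtrace_diag.
have /esym : char_poly (U^T *m diag_mx d *m U) =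
    \prod_(x <- [seq d 0 i | i <- enum 'I_n]) ('X - x%:P).
  rewrite big_map big_enum /=.
  have -> : \prod_(i < n) ('X - (d 0 i)%:P) = char_poly (diag_mx d).
    rewrite char_poly_trig ?diag_mx_is_trig//.
    by apply: eq_bigr => i _; rewrite mxE eqxx.
  rewrite /char_poly; have -> : char_poly_mx (U^T *m diag_mx d *m U) =
      map_mx polyC U^T *m char_poly_mx (diag_mx d) *m map_mx polyC U.
    rewrite /char_poly_mx mulmxBr mulmxBl !map_mxM/= scalar_mxC -mulmxA.
    by rewrite -!mulmxA -(map_mxM polyC U^T U) (mulmx1C UU) map_mx1 mulmx1.
  rewrite !det_mulmx mulrAC -det_mulmx -map_mxM (mulmx1C UU).
  by rewrite map_mx1 det1 mul1r.
rewrite Al => /prod_XsubC_eq /(perm_big _) <-.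
by rewrite big_map big_enum /=; apply: eq_bigr => i _; rewrite mxE.
Qed.

End functional_calculus.

Section cons_measure.
Context {R : realType} {m : nat}.
Variable mu : {sigma_finite_measure set (m.-tuple R) -> \bar R}.

Definition tuple_of_pair (p : measurableTypeR R * m.-tuple R) : m.+1.-tuple R :=
  cons_tuple (p.1 : R) p.2.

Lemma measurable_tuple_of_pair : measurable_fun setT tuple_of_pair.
Proof.
have m1 : measurable_fun setT
    (fun p : measurableTypeR R * m.-tuple R => p.1 : R) by exact: measurable_fst.
have m2 : measurable_fun setT
    (fun p : measurableTypeR R * m.-tuple R => p.2) by exact: measurable_snd.
exact: (measurable_cons m1 m2).
Qed.

Definition cons_measure : set (m.+1.-tuple R) -> \bar R :=
  pushforward (lebesgue_measure \x mu)%E tuple_of_pair.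

Let cons_measure0 : cons_measure set0 = 0%E.
Proof. by rewrite /cons_measure /pushforward preimage_set0 measure0. Qed.

Let cons_measure_ge0 A : (0 <= cons_measure A)%E.
Proof. by rewrite /cons_measure /pushforward measure_ge0. Qed.

Let cons_measure_sigma_additive : semi_sigma_additive cons_measure.
Proof.
have mf := measurable_tuple_of_pair.
move=> F mF tF mUF; rewrite /cons_measure /pushforward preimage_bigcup.
apply: measure_semi_sigma_additive.
- by move=> n; rewrite -[X in measurable X]setTI; exact: mf.
- apply/trivIsetP => /= i j _ _ ij; rewrite -preimage_setI.
  by move/trivIsetP : tF => /(_ _ _ _ _ ij) ->//; rewrite preimage_set0.
- by rewrite -preimage_bigcup -[X in measurable X]setTI; exact: mf.
Qed.

HB.instance Definition _ := isMeasure.Build _ _ _ cons_measure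
  cons_measure0 cons_measure_ge0 cons_measure_sigma_additive.

Let head_behead_measurable (A : set R) (B : set (m.-tuple R)) :
  measurable A -> measurable B ->
  measurable [set t : m.+1.-tuple R | A (thead t) /\ B (behead_tuple t)].
Proof.
move=> mA mB; apply: measurableI.
  by have := @measurable_tnth _ R m.+1 ord0 measurableT A mA; rewrite setTI.
by have := @measurable_behead _ R m measurableT B mB; rewrite setTI.
Qed.

Lemma cons_measureX (A : set (measurableTypeR R)) (B : set (m.-tuple R)) :
  measurable A -> measurable B ->
  cons_measure [set t | A (thead t) /\ B (behead_tuple t)] =
  (lebesgue_measure A * mu B)%E.
Proof.
move=> mA mB; rewrite -product_measure1E// /cons_measure /pushforward.
have behead_cons (p : measurableTypeR R * m.-tuple R) :
    behead_tuple (tuple_of_pair p) = p.2 by exact/val_inj.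
by congr (_ _); apply/seteqP; split=> p /=; rewrite behead_cons.
Qed.

Let cons_measure_sigma_finite : sigma_finite setT cons_measure.
Proof.
have /sigma_finiteP[F [TF ndF Foo]] := sigma_finiteT (@lebesgue_measure R).
have /sigma_finiteP[G [TG ndG Goo]] := sigma_finiteT mu.
exists (fun k => [set t | F k (thead t) /\ G k (behead_tuple t)]).
  apply/seteqP; split=> // t _.
  have [i _ Fi] : (\bigcup_k F k) (thead t) by rewrite -TF.
  have [j _ Gj] : (\bigcup_k G k) (behead_tuple t) by rewrite -TG.
  exists (maxn i j) => //; split.
    by move: (thead t) Fi; exact/subsetPset/ndF/leq_maxl.
  by move: (behead_tuple t) Gj; exact/subsetPset/ndG/leq_maxr.
move=> k; have [mF Fkoo] := Foo k; have [mG Gkoo] := Goo k.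
split; first exact: head_behead_measurable.
by rewrite cons_measureX// lte_mul_pinfty// ge0_fin_numE.
Qed.

HB.instance Definition _ := Measure_isSigmaFinite.Build _ _ _ cons_measure
  cons_measure_sigma_finite.

End cons_measure.

(* Lebesgue measure on R^m as an iterated product of 1-dimensional ones;
   lebesgue_tuple_box gives its value on boxes. *)
Fixpoint lebesgue_tuple (R : realType) (m : nat) :
    {sigma_finite_measure set (m.-tuple R) -> \bar R} :=
  match m with
  | 0 => \d_([tuple] : 0.-tuple R)
  | m'.+1 => cons_measure (lebesgue_tuple R m')
  end.

Lemma lebesgue_tuple_box (R : realType) m (A : 'I_m -> set R) :
  (forall i, measurable (A i)) ->
  lebesgue_tuple R m [set t | forall i, A i (tnth t i)] =
  (\prod_(i < m) lebesgue_measure (A i : set (measurableTypeR R)))%E.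
Proof.
elim: m A => [|m IH] A mA.
  by rewrite big_ord0 /= diracE mem_set// => -[].
pose B := [set t : m.-tuple R | forall i, A (lift ord0 i) (tnth t i)].
have mB : measurable B.
  rewrite (_ : B = \bigcap_(i in setT) [set t | A (lift ord0 i) (tnth t i)]).
    apply: fin_bigcap_measurable => [|i _]; first exact: finite_finset.
    have := @measurable_tnth _ R m i measurableT _ (mA (lift ord0 i)).
    by rewrite setTI.
  by apply/seteqP; split=> [t Bt i _|t Bt i]; [exact: Bt|exact: Bt i I].
rewrite big_ord_recl -IH; last by move=> i; exact: mA.
rewrite -cons_measureX; [|exact: mA|exact: mB].
rewrite /=; congr cons_measure.
apply/seteqP; split=> t /=.
  move=> At; split=> [|i]; first exact: At.
  by have := At (lift ord0 i); rewrite [t in tnth t]tuple_eta tnthS.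
move=> [A0 AS] i; have [j ->|->//] := unliftP ord0 i.
by have := AS j; rewrite [t in _ -> _ (tnth t _)]tuple_eta tnthS.
Qed.

Section symmetric_coordinates.
Context {R : realType} {n : nat}.

(* Positions on and above the diagonal. to_triu and of_triu identify the
   symmetric matrices with R^(n(n+1)/2); the order in which the positions are
   listed is irrelevant, Lebesgue measure being permutation invariant. *)
Definition triu : seq ('I_n * 'I_n) :=
  [seq ij : 'I_n * 'I_n <- enum {: 'I_n * 'I_n} | (ij.1 <= ij.2)%N].

Lemma size_triu : size triu = (n * n.+1)./2.
Proof.
rewrite mulnC -(bin2 n.+1) -bin2_sum.
rewrite big_mkord big_ord_recl add0n size_filter -sum1_count big_enum_cond /=.
rewrite -(pair_big_dep xpredT (fun i j : 'I_n => (i <= j)%N) (fun _ _ => 1%N)).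
rewrite (exchange_big_dep xpredT)//=; apply: eq_bigr => j _.
rewrite (eq_bigl (fun i : 'I_n => (i < j.+1)%N))// -(big_ord_widen n (fun=> 1%N))//.
by rewrite sum1_card card_ord.
Qed.

Definition to_triu (A : 'M[R]_n) : (size triu).-tuple R :=
  map_tuple (fun ij => A ij.1 ij.2) (in_tuple triu).

Definition of_triu (x : (size triu).-tuple R) : 'M[R]_n :=
  \matrix_(i, j) nth 0 x (index (if (i <= j)%N then (i, j) else (j, i)) triu).

Lemma of_triu_sym x : of_triu x \is symmetricmx.
Proof.
rewrite qualifE /= expr0 scale1r map_mx_id//; apply/eqP/matrixP => i j.
rewrite !mxE; congr (nth _ _ (index _ _)).
by case: ltngtP => // /val_inj ->.
Qed.

Lemma to_triuK A : A \is symmetricmx -> of_triu (to_triu A) = A.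
Proof.
rewrite qualifE /= expr0 scale1r map_mx_id// => /eqP AT.
apply/matrixP => i j; rewrite mxE.
set ij := (if _ then _ else _).
have ijP : ij \in triu.
  by rewrite mem_filter mem_enum andbT /ij; case: (leqP i j) => //= /ltnW.
rewrite /to_triu /= (nth_map ij) ?index_mem// nth_index// /ij.
by case: (leqP i j) => //= _; rewrite [in LHS]AT mxE.
Qed.

Lemma of_triuK x : to_triu (of_triu x) = x.
Proof.
apply: (@eq_from_tnth _ _) => k; rewrite tnth_map mxE.
have := mem_tnth k (in_tuple triu); rewrite mem_filter => /andP[le_ij _].
rewrite le_ij -surjective_pairing (tnth_nth (tnth (in_tuple triu) k)) /=.
rewrite index_uniq ?filter_uniq ?enum_uniq//.
  by rewrite (tnth_nth 0).
by rewrite -enumT enum_uniq.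
Qed.

End symmetric_coordinates.
Arguments triu : clear implicits.

Section ensemble.
Context {R : realType}.

Definition ensemble_weight n (Q : R -> R) (x : (size (triu n)).-tuple R) : R :=
  expR (- \tr (mxfun Q (of_triu x))).

Definition partition_function n (Q : R -> R) : \bar R :=
  (\int[lebesgue_tuple R (size (triu n))]_x (@ensemble_weight n Q x)%:E)%E.

(* The law of M on the symmetric matrices is stated through the independent
   entries: the vector to_triu (M w) has density exp(- tr Q) / Z_n with respect
   to Lebesgue measure. *)
Record orthogonally_invariant_ensemble d (T : measurableType d)
    (P : probability T R) n (Q : R -> R) (M : T -> 'M[R]_n) : Prop := {
  ensemble_potential_measurable : measurable_fun setT Q ;
  ensemble_partition_gt0 : (0 < partition_function n Q)%E ;
  ensemble_partition_lty : (partition_function n Q < +oo)%E ;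
  ensemble_sym : forall w, M w \is symmetricmx ;
  ensemble_measurable : measurable_fun setT (to_triu \o M) ;
  ensemble_law : forall A : set ((size (triu n)).-tuple R), measurable A ->
    P ((to_triu \o M) @^-1` A) =
    (\int[lebesgue_tuple R (size (triu n))]_(x in A)
       ((fine (partition_function n Q))^-1 * ensemble_weight Q x)%:E)%E }.

Definition controllability_mx n (A : 'M[R]_n) (b : 'cV[R]_n) : 'M[R]_n :=
  \matrix_(i, j) (A ^+ j *m b) i 0.

Definition controllable n (A : 'M[R]_n) (b : 'cV[R]_n) : Prop :=
  \rank (controllability_mx A b) = n.

End ensemble.

(* Main.v *)
(* The law of M has a density, so it suffices that the symmetric matrices A with
   (A, b) not controllable form a Lebesgue null set. That set is the zero locus
   of det (b, A b, ..., A^(n-1) b), a polynomial in the entries of A. The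
   polynomial is not identically zero: choose U orthogonal with U b proportional
   to the all-ones vector and A = U^T diag(l) U with distinct l_i; then the
   determinant is a nonzero multiple of the Vandermonde determinant of l.
   The zero locus of a nonzero polynomial is null by induction on the number of
   variables: all but finitely many values of the first variable leave a nonzero
   polynomial in the remaining ones. *)
Require Import Defs.
From HB Require Import structures.
From mathcomp Require Import all_boot all_order all_algebra.
From mathcomp Require Import all_classical all_reals all_analysis.
From mathcomp Require Import measurable_realfun.

Set Implicit Arguments.
Unset Strict Implicit.
Unset Printing Implicit Defensive.

Import Order.TTheory GRing.Theory Num.Theory.
Import numFieldNormedType.Exports.

Local Open Scope classical_set_scope.
Local Open Scope ring_scope.

(** * Integrals over null sets *)

Section null_integral.
Import HBNNSimple.
Context d (T : measurableType d) (R : realType).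
Variable mu : {measure set T -> \bar R}.

(* Unlike null_set_integral, f need not be measurable; this spares proving
   that the spectral functional tr Q(M) is measurable in M. *)
Lemma ge0_null_set_integral (N : set T) (f : T -> \bar R) :
  measurable N -> mu N = 0%E -> (forall x, N x -> 0 <= f x)%E ->
  (\int[mu]_(x in N) f x = 0)%E.
Proof.
move=> mN N0 f0; apply/eqP; rewrite eq_le integral_ge0// andbT.
rewrite ge0_integralE//; apply: ge_ereal_sup => _ [h hf <-].
(* A simple [h] below the restriction of [f] to [N] vanishes off [N], so its integral is that of a
   measurable function over a null set. *)
rewrite -integralT_nnsfun (_ : (fun x => (h x)%:E) = (EFin \o h) \_ N).
  rewrite -integral_mkcond null_set_integral//.
  by apply/measurable_EFinP; exact: measurable_funTS.
apply/funext => x; rewrite patchE; case: ifPn => // xN.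
apply/eqP; rewrite eqe eq_le fun_ge0 andbT -lee_fin.
by have := hf x; rewrite patchE (negbTE xN).
Qed.

End null_integral.

(** * Polynomial functions and their zero sets *)

Section polynomial_functions.
Context {R : realType}.

(** Polynomials enter only as functions, so measurability and the restrictions to some of the
    variables follow by induction on this predicate. *)
Inductive polyfun m : (m.-tuple R -> R) -> Prop :=
| polyfun_cst c : polyfun (fun=> c)
| polyfun_tnth i : polyfun (fun x => tnth x i)
| polyfunD f g : polyfun f -> polyfun g -> polyfun (fun x => f x + g x)
| polyfunM f g : polyfun f -> polyfun g -> polyfun (fun x => f x * g x).

Lemma polyfun_sum m I (r : seq I) (f : I -> m.-tuple R -> R) :
  (forall i, polyfun (f i)) -> polyfun (fun x => \sum_(i <- r) f i x).
Proof.
move=> pf; elim: r => [|i r IH].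
  by under eq_fun do rewrite big_nil; exact: polyfun_cst.
by under eq_fun do rewrite big_cons; exact: polyfunD.
Qed.

Lemma polyfun_prod m I (r : seq I) (f : I -> m.-tuple R -> R) :
  (forall i, polyfun (f i)) -> polyfun (fun x => \prod_(i <- r) f i x).
Proof.
move=> pf; elim: r => [|i r IH].
  by under eq_fun do rewrite big_nil; exact: polyfun_cst.
by under eq_fun do rewrite big_cons; exact: polyfunM.
Qed.

Lemma polyfun_nth m k : polyfun (fun x : m.-tuple R => nth 0 x k).
Proof.
have [km|mk] := ltnP k m.
  under eq_fun do rewrite -(tnth_nth 0 _ (Ordinal km)).
  exact: polyfun_tnth.
under eq_fun do rewrite nth_default ?size_tuple//.
exact: polyfun_cst.
Qed.

Lemma polyfun_mulmx m p q r (A : m.-tuple R -> 'M[R]_(p, q))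
    (B : m.-tuple R -> 'M[R]_(q, r)) :
  (forall i j, polyfun (fun x => A x i j)) ->
  (forall i j, polyfun (fun x => B x i j)) ->
  forall i j, polyfun (fun x => (A x *m B x) i j).
Proof.
move=> pA pB i j; under eq_fun do rewrite mxE.
by apply: polyfun_sum => k; exact: polyfunM.
Qed.

Lemma polyfun_exprmx m n (A : m.-tuple R -> 'M[R]_n) k :
  (forall i j, polyfun (fun x => A x i j)) ->
  forall i j, polyfun (fun x => (A x ^+ k) i j).
Proof.
move=> pA; elim: k => [|k IH] i j.
  under eq_fun do rewrite expr0.
  exact: polyfun_cst.
under eq_fun do rewrite exprS.
exact: polyfun_mulmx.
Qed.

Lemma polyfun_det m n (A : m.-tuple R -> 'M[R]_n) :
  (forall i j, polyfun (fun x => A x i j)) -> polyfun (fun x => \det (A x)).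
Proof.
move=> pA; apply: polyfun_sum => s; apply: polyfunM; first exact: polyfun_cst.
by apply: polyfun_prod => i; exact: pA.
Qed.

Lemma polyfun_measurable m (f : m.-tuple R -> R) :
  polyfun f -> measurable_fun setT f.
Proof.
elim=> [c|i|g h _ mg _ mh|g h _ mg _ mh].
- exact: measurable_cst.
- exact: measurable_tnth.
- exact: measurable_funD.
- exact: measurable_funM.
Qed.

Lemma polyfun_zeros_measurable m (f : m.-tuple R -> R) :
  polyfun f -> measurable [set x | f x = 0].
Proof.
move=> /polyfun_measurable/(_ measurableT _ (measurable_set1 0)).
by rewrite setTI.
Qed.

Lemma polyfun_tail m (f : m.+1.-tuple R -> R) (a : R) :
  polyfun f -> polyfun (fun x : m.-tuple R => f (cons_tuple a x)).
Proof.
elim=> [c|i|g h _ pg _ ph|g h _ pg _ ph].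
- exact: polyfun_cst.
- have [j ->|->] := unliftP ord0 i.
    by under eq_fun do rewrite tnthS; exact: polyfun_tnth.
  by under eq_fun do rewrite tnth0; exact: polyfun_cst.
- exact: polyfunD.
- exact: polyfunM.
Qed.

Lemma polyfun_head m (f : m.+1.-tuple R -> R) (x : m.-tuple R) :
  polyfun f -> exists p : {poly R}, forall a, f (cons_tuple a x) = p.[a].
Proof.
elim=> [c|i|g h _ [p pE] _ [q qE]|g h _ [p pE] _ [q qE]].
- by exists c%:P => a; rewrite hornerC.
- have [j ->|->] := unliftP ord0 i.
    by exists (tnth x j)%:P => a; rewrite tnthS hornerC.
  by exists 'X => a; rewrite tnth0 hornerX.
- by exists (p + q) => a; rewrite hornerD pE qE.
- by exists (p * q) => a; rewrite hornerM pE qE.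
Qed.

(** An infinite root set would contain [size p] distinct roots, one more than the degree allows. *)
Lemma finite_poly_roots (p : {poly R}) : p != 0 ->
  finite_set [set a : R | p.[a] = 0].
Proof.
move=> p0; apply: contrapT => /(@infinite_set_fset _ _ (size p))[C CP sC].
have : (size (finmap.enum_fset C) < size p)%N.
  apply: max_poly_roots => //; last exact: finmap.fset_uniq.
  by apply/allP => a aC; apply/rootP; exact: CP.
by rewrite ltnNge sC.
Qed.

Lemma polyfun_zeros_null m (f : m.-tuple R -> R) : polyfun f ->
  (exists x, f x != 0) -> lebesgue_tuple R m [set x | f x = 0] = 0%E.
Proof.
elim: m f => [|m IH] f pf [x fx].
  (* In dimension 0 the measure is the Dirac mass at the empty tuple, where [f] is nonzero. *)
  rewrite /= diracE memNset//= => f0; move: fx.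
  by rewrite (tuple0 x) f0 eqxx.
rewrite /= /cons_measure /pushforward.
set Z := (X in product_measure1 _ _ X).
have mZ : measurable Z.
  rewrite -[Z]setTI; apply: (@measurable_tuple_of_pair R m) => //.
  exact: polyfun_zeros_measurable.
(* [p] is [f] along the line through [x] in the direction of the first coordinate; it is nonzero
   because [f x] is. *)
have [p pE] := polyfun_head (behead_tuple x) pf.
have p0 : p != 0.
  apply: contraNneq fx => p0.
  by rewrite [x]tuple_eta pE p0 horner0.
rewrite /product_measure1.
rewrite (ae_eq_integral (cst 0%E))//.
- by rewrite integral0.
- exact: measurable_fun_xsection.
(* By Fubini it suffices that almost every section of [Z] is null. The exceptional values are the
   roots of [p]: at any other [a], the tail of [f] is nonzero at [behead_tuple x], and the induction
   hypothesis applies. *)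
- exists [set a | p.[a] = 0]; split.
  + apply: countable_measurable; first exact: measurable_set1.
    exact/finite_set_countable/finite_poly_roots.
  + exact/countable_lebesgue_measure0/finite_set_countable/finite_poly_roots.
  + move=> a /= H; apply: contrapT => pa; apply: H => _.
    rewrite (_ : xsection Z a = [set y | f (cons_tuple a y) = 0]).
      apply: IH; first exact: polyfun_tail.
      by exists (behead_tuple x); rewrite pE; apply/eqP.
    by apply/seteqP; split=> y; rewrite /xsection /= inE.
Qed.

End polynomial_functions.

(** * Controllability as a determinant condition, and a controllable symmetric matrix *)

Section controllability.
Context {R : realType}.

Lemma controllable_det n (A : 'M[R]_n) (b : 'cV[R]_n) :
  controllable A b <-> \det (controllability_mx A b) != 0.
Proof.
rewrite -unitfE -unitmxE -row_free_unit /row_free /controllable.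
by split=> [->|/eqP].
Qed.

(** With [A] the conjugated matrix, [A ^+ k *m b] is [c] times [U^T] applied to the k-th powers of
    [l], so the controllability matrix factors through a transposed Vandermonde matrix. *)
Lemma controllable_conj n (U : 'M[R]_n) (l : 'rV[R]_n) (c : R) (b : 'cV[R]_n) :
  U *m U^T = 1%:M -> c != 0 -> (forall i j, i != j -> l 0 i != l 0 j) ->
  U *m b = c *: const_mx 1 ->
  controllable (U^T *m diag_mx l *m U) b.
Proof.
move=> UU c0 linj Ub; apply/controllable_det.
have bE : b = c *: (U^T *m const_mx 1).
  by rewrite scalemxAr -Ub mulmxA (mulmx1C UU) mul1mx.
have powE k : (U^T *m diag_mx l *m U) ^+ k *m b =
    c *: (U^T *m (\col_i (l 0 i ^+ k))).
  elim: k => [|k IH].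
    rewrite expr0 mul1mx bE; congr (_ *: (_ *m _)).
    by apply/matrixP => i j; rewrite !mxE.
  rewrite exprS -[_ * _]/(_ *m _) -mulmxA IH -scalemxAr; congr (_ *: _).
  rewrite -!mulmxA (mulmxA U) UU mul1mx; congr (_ *m _).
  by apply/matrixP => i j; rewrite mul_diag_mx !mxE exprS.
have -> : controllability_mx (U^T *m diag_mx l *m U) b =
    c *: (U^T *m (Vandermonde n l)^T).
  apply/matrixP => i j; rewrite mxE powE !mxE; congr (_ * _).
  by apply: eq_bigr => k _; rewrite !mxE.
rewrite detZ det_mulmx !det_tr det_Vandermonde !mulf_neq0 ?expf_neq0//.
  by rewrite -unitfE -unitmxE; have [] := mulmx1_unit UU.
apply/prodf_neq0 => i _; apply/prodf_neq0 => j ij.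
by rewrite subr_eq0 linj// neq_ltn ij orbT.
Qed.

Lemma mulmx_tr_gt0 n (v : 'rV[R]_n) : v != 0 -> 0 < (v *m v^T) 0 0.
Proof.
move=> v0; rewrite lt_def mxE; under eq_bigr do rewrite [v^T _ _]mxE -expr2.
rewrite sumr_ge0 ?andbT; last by move=> i _; exact: sqr_ge0.
apply: contra_neqN v0 => /eqP /psumr_eq0P H; apply/rowP => i.
by move: (H (fun i _ => sqr_ge0 _) i isT) => /eqP; rewrite sqrf_eq0 mxE => /eqP.
Qed.

(** Take [H] orthogonal with first row [v] normalized; its other rows are orthogonal to [v], and [c]
    is the norm of [v]. *)
Lemma orthogonal_to_axis n (v : 'cV[R]_n.+1) : v != 0 ->
  exists (H : 'M[R]_n.+1) (c : R),
    [/\ H *m H^T = 1%:M, c != 0 & H *m v = c *: delta_mx 0 0].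
Proof.
move=> v0; pose s := (v^T *m v) 0 0.
have s0 : 0 < s.
  have := @mulmx_tr_gt0 _ v^T; rewrite trmxK; apply.
  by apply: contra_neq v0 => /(congr1 trmx); rewrite trmxK trmx0.
have r0 : Num.sqrt s != 0 by rewrite sqrtr_eq0 -ltNge.
have [|H [HH Hv]] := @householder R n ((Num.sqrt s)^-1 *: v^T).
  rewrite linearZ/= trmxK -scalemxAr -scalemxAl scalerA [v^T *m v]mx11_scalar -/s.
  by rewrite scale_scalar_mx -invfM -expr2 sqr_sqrtr ?ltW// mulVf ?gt_eqF.
exists H, (Num.sqrt s); split=> //.
have -> : v = Num.sqrt s *: (row 0 H)^T.
  by rewrite Hv linearZ/= trmxK scalerA mulfV// scale1r.
by rewrite -scalemxAr -[H in H *m _]trmxK -trmx_mul -row_mul HH row1 trmx_delta.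
Qed.

Lemma exists_controllable n (b : 'cV[R]_n) : b != 0 ->
  exists2 A : 'M[R]_n, A \is symmetricmx & controllable A b.
Proof.
case: n b => [|n] b b0; first by rewrite flatmx0 eqxx in b0.
have one0 : const_mx 1 != 0 :> 'cV[R]_n.+1.
  by apply/eqP => /matrixP/(_ 0 0); rewrite !mxE => /eqP; rewrite oner_eq0.
have [H [c [HH c0 Hb]]] := orthogonal_to_axis b0.
have [K [e [KK e0 K1]]] := orthogonal_to_axis one0.
(* [H] sends [b] to the first axis, and [K^T] sends that axis to the line of the all-ones vector.
   The eigenvalues 0, 1, ..., n are distinct in characteristic zero. *)
pose U := K^T *m H; pose l : 'rV[R]_n.+1 := \row_i (i : nat)%:R.
have UU : U *m U^T = 1%:M.
  by rewrite /U trmx_mul trmxK mulmxA -(mulmxA _ H) HH mulmx1 (mulmx1C KK).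
have Ub : U *m b = (c / e) *: const_mx 1.
  have -> : const_mx 1 = e *: (K^T *m delta_mx 0 0) :> 'cV[R]_n.+1.
    by rewrite scalemxAr -K1 mulmxA (mulmx1C KK) mul1mx.
  by rewrite /U -mulmxA Hb -scalemxAr scalerA divfK.
clearbody U; exists (U^T *m diag_mx l *m U).
  rewrite qualifE /= expr0 scale1r map_mx_id//.
  by rewrite !trmx_mul trmxK tr_diag_mx mulmxA.
apply: controllable_conj Ub => //; first by rewrite mulf_neq0 ?invr_eq0.
by move=> i j ij; rewrite !mxE eqr_nat.
Qed.

Lemma polyfun_controllability n (b : 'cV[R]_n) :
  polyfun (fun x => \det (controllability_mx (of_triu x) b)).
Proof.
apply: polyfun_det => i j; under eq_fun do rewrite mxE.
apply: polyfun_mulmx => [|k l]; last exact: polyfun_cst.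
apply: polyfun_exprmx => k l; under eq_fun do rewrite mxE.
exact: polyfun_nth.
Qed.

End controllability.

Theorem theorem4 (R : realType) (n : nat) (d : measure_display)
    (T : measurableType d) (P : probability T R) (Q : R -> R)
    (M : T -> 'M[R]_n) (b : 'cV[R]_n) :
  orthogonally_invariant_ensemble P Q M ->
  b != 0 ->
  measurable [set w | controllable (M w) b] /\
  P [set w | controllable (M w) b] = 1%E.
Proof.
move=> [_ Z0 Zoo Msym mM law] b0.
pose f (x : (size (triu n)).-tuple R) :=
  \det (controllability_mx (of_triu x) b).
have pf : polyfun f := polyfun_controllability b.
pose N := [set x | f x = 0].
have mN : measurable N := polyfun_zeros_measurable pf.
have mMN : measurable ((to_triu \o M) @^-1` N).
  by rewrite -[X in measurable X]setTI; exact: mM.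
(* Symmetry of [M w] makes it recoverable from its upper triangular entries, so [f] evaluated there
   is its controllability determinant. *)
have -> : [set w | controllable (M w) b] = ~` ((to_triu \o M) @^-1` N).
  apply/seteqP; split=> w; rewrite /= /N /= /f to_triuK//.
    by move=> /controllable_det/eqP.
  by move=> /eqP/controllable_det.
split; first exact: measurableC.
(* The complement has probability the integral of the density over the null set [N]. *)
rewrite probability_setC// law// ge0_null_set_integral ?sube0//.
  have [A As /controllable_det Ac] := exists_controllable b0.
  apply: polyfun_zeros_null pf _.
  by exists (to_triu A); rewrite /f to_triuK.
move=> x _; rewrite lee_fin mulr_ge0 ?expR_ge0// invr_ge0 fine_ge0//.
exact: ltW.
Qed.
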